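(* Let $\langle\mathbf{A}_{\mathrm d},\mathbf{A},\iota\rangle$ be a (generalized) additive quantale with multiplication, let $\mathbf{P}$ and $\mathbf{Q}$ be projective $\mathbf{A}$-modules, and let $\gamma$ and $\delta$ be structural nuclei on $\mathbf{P}$ and $\mathbf{Q}$ respectively. Then $\mathbf{P}_\gamma$ and $\mathbf{Q}_\delta$ are isomorphic $\mathbf{A}$-modules if and only if there are module homomorphisms $\tau\colon\mathbf{P}\to\mathbf{Q}$ and $\rho\colon\mathbf{Q}\to\mathbf{P}$ such that for all $\Gamma,\Delta\in P$ and $E,F\in Q$: (1) $\Gamma\vdash_\gamma\Delta\iff\tau(\Gamma)\vdash_\delta\tau(\Delta)$, and $E\vdash_\delta(\tau\circ\rho)(E)\vdash_\delta E$; (2) $E\vdash_\delta F\iff\rho(E)\vdash_\gamma\rho(F)$, and $\Gamma\vdash_\gamma(\rho\circ\tau)(\Gamma)\vdash_\gamma\Gamma$. Moreover, module homomorphisms $\tau,\rho$ satisfy the conditions in (1) (for all $\Gamma,\Delta,E$) if and only if they satisfy the conditions in (2) (for all $E,F,\Gamma$).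
   Context: Fix one of two parallel settings: plain (''joins'' = joins of arbitrary families) or generalized (''joins'' = joins of non-empty families). A (generalized) quantale is $\langle Q,\bigvee,+,\mathsf{0}\rangle$ with $Q$ a poset having all such joins, $\langle Q,+,\mathsf{0}\rangle$ a monoid with $+$ order-preserving and distributing over such joins on both sides. A (generalized) additive quantale with multiplication is a triple $\langle\mathbf{A}_{\mathrm d},\mathbf{A},\iota\rangle$: $\mathbf{A}_{\mathrm d}$ a monoid, $\mathbf{A}$ a (generalized) quantale with an additional monoid structure $\langle A,\cdot,\mathsf 1\rangle$, $\iota$ a monoid homomorphism, such that $(\bigvee_i a_i)\cdot b=\bigvee_i(a_i\cdot b)$, $(a+b)\cdot c=a\cdot c+b\cdot c$, $\mathsf0\cdot a=\mathsf0$, and for $d\in\mathbf{A}_{\mathrm d}$ left multiplication by $\iota(d)$ preserves joins, $+$, $\mathsf0$. An $\mathbf{A}$-module is a (generalized) quantale $\mathbf{Q}$ with $\ast\colon A\times Q\to Q$, order-preserving in both coordinates, with $(a\cdot b)\ast x=a\ast(b\ast x)$, $\mathsf1\ast x=x$, $(a+b)\ast x=a\ast x+b\ast x$, $\mathsf0\ast x=\mathsf0$, $(\bigvee_i a_i)\ast x=\bigvee_i(a_i\ast x)$, and $x\mapsto\iota(d)\ast x$ preserving $+$, $\mathsf0$, joins for $d\in\mathbf{A}_{\mathrm d}$; module homomorphisms are quantale homomorphisms $f$ with $f(a\ast x)=a\ast f(x)$. A module $\mathbf{P}$ is projective if for every surjective module homomorphism $g\colon\mathbf{R}\to\mathbf{S}$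 and module homomorphism $h\colon\mathbf{P}\to\mathbf{S}$ there is a module homomorphism $h'\colon\mathbf{P}\to\mathbf{R}$ with $g\circ h'=h$. A structural nucleus on a module $\mathbf{Q}$ is an order-preserving, expansive, idempotent map $\gamma$ with $\gamma(x)+\gamma(y)\le\gamma(x+y)$ and $a\ast\gamma(x)\le\gamma(a\ast x)$ for all $a$; $\mathbf{Q}_\gamma$ is the module on $\gamma[Q]$ with $\bigvee_\gamma X=\gamma(\bigvee X)$, $x+_\gamma y=\gamma(x+y)$, $\mathsf0_\gamma=\gamma(\mathsf0)$, $a\ast_\gamma x=\gamma(a\ast x)$. For a nucleus $\gamma$, the relation $\vdash_\gamma$ is defined by $x\vdash_\gamma y\iff y\leq\gamma(x)$; chains $x\vdash y\vdash z$ abbreviate $x\vdash y$ and $y\vdash z$. *)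

(* Defs.v *)
From HB Require Import structures.
From mathcomp Require Import all_boot all_order.
From mathcomp Require Import boolp classical_sets.

Set Implicit Arguments.
Unset Strict Implicit.
Unset Printing Implicit Defensive.

Import Order.TTheory.

Local Open Scope classical_set_scope.
Local Open Scope order_scope.
Local Open Scope group_scope.

(* The two parallel settings: joins of arbitrary families, or joins of
   non-empty families.  The join of a family is the join of its range. *)
Inductive setting := Plain | Generalized.

Definition admissible (s : setting) (T : Type) (X : set T) : Prop :=
  match s with Plain => True | Generalized => X !=set0 end.

Lemma admissible_image (s : setting) (T U : Type) (f : T -> U) (X : set T) :
  admissible s X -> admissible s (f @` X).
Proof. by case: s => //= -[x Xx]; exists (f x), x. Qed.

(* qjoin is a total operation on subsets; its value on a set which is not
   admissible is unspecified and is never used. *)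
HB.mixin Record POrder_isQuantale (s : setting) (d : Order.disp_t) (T : Type)
    of Order.POrder d T := {
  qjoin : set T -> T;
  qadd : T -> T -> T;
  qzero : T;
  qjoin_supremum : forall X, admissible s X -> supremums X (qjoin X);
  qaddA : associative qadd;
  qadd0q : left_id qzero qadd;
  qaddq0 : right_id qzero qadd;
  qadd_le : forall x x' y y', x <= x' -> y <= y' -> qadd x y <= qadd x' y';
  qadd_joinl : forall X y, admissible s X ->
    qadd (qjoin X) y = qjoin [set qadd x y | x in X];
  qadd_joinr : forall X y, admissible s X ->
    qadd y (qjoin X) = qjoin [set qadd y x | x in X];
}.

#[short(type="quantaleType")]
HB.structure Definition Quantale (s : setting) (d : Order.disp_t) :=
  {T of Order.POrder d T & POrder_isQuantale s d T}.

(* Only the joins of the setting have to be preserved. *)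
Record quantale_hom (s : setting) (d1 d2 : Order.disp_t)
    (Q : quantaleType s d1) (R : quantaleType s d2) (f : Q -> R) : Prop := {
  qhom_join : forall X, admissible s X -> f (qjoin X) = qjoin (f @` X);
  qhom_add : {morph f : x y / qadd x y};
  qhom0 : f qzero = qzero;
}.

(* The triple (Ad, A, iota): Ad is a parameter, and iota is the field qiota. *)
HB.mixin Record Quantale_isAddQuantaleMul (s : setting) (Ad : monoidType)
    (d : Order.disp_t) (A : Type) of Quantale s d A & Monoid A := {
  qiota : Ad -> A;
  iota_monoid_morphism : monoid_morphism qiota;
  qmul_joinl : forall (X : set A) (b : A), admissible s X ->
    qjoin X * b = qjoin [set a * b | a in X];
  qmulDl : forall a b c : A, qadd a b * c = qadd (a * c) (b * c);
  qmul0q : forall a : A, (qzero : A) * a = qzero;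
  qmul_iota_hom : forall c : Ad, quantale_hom (fun a : A => qiota c * a);
}.

#[short(type="addQuantaleMulType")]
HB.structure Definition AddQuantaleMul (s : setting) (Ad : monoidType)
    (d : Order.disp_t) :=
  {A of Quantale s d A & Monoid A & Quantale_isAddQuantaleMul s Ad d A}.

HB.mixin Record Quantale_isQModule (s : setting) (Ad : monoidType)
    (dA : Order.disp_t) (A : addQuantaleMulType s Ad dA) (d : Order.disp_t)
    (Q : Type) of Quantale s d Q := {
  qact : A -> Q -> Q;
  qact_le : forall a a' x x', a <= a' -> x <= x' -> qact a x <= qact a' x';
  qactM : forall a b x, qact (a * b) x = qact a (qact b x);
  qact1 : forall x, qact (1 : A) x = x;
  qactDl : forall a b x, qact (qadd a b) x = qadd (qact a x) (qact b x);
  qact0 : forall x, qact (qzero : A) x = qzero;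
  qact_joinl : forall (X : set A) x, admissible s X ->
    qact (qjoin X) x = qjoin [set qact a x | a in X];
  qact_iota_hom : forall c : Ad, quantale_hom (qact (qiota c));
}.

#[short(type="qmodType")]
HB.structure Definition QModule (s : setting) (Ad : monoidType)
    (dA : Order.disp_t) (A : addQuantaleMulType s Ad dA) (d : Order.disp_t) :=
  {Q of Quantale s d Q & Quantale_isQModule s Ad dA A d Q}.

Section ModuleTheory.
Context {s : setting} {Ad : monoidType} {dA : Order.disp_t}.
Context {A : addQuantaleMulType s Ad dA}.

Record module_hom (d1 d2 : Order.disp_t) (P : qmodType A d1)
    (Q : qmodType A d2) (f : P -> Q) : Prop := {
  mhom_quantale :> quantale_hom f;
  mhom_act : forall (a : A) x, f (qact a x) = qact a (f x);
}.

Definition module_isomorphic (d1 d2 : Order.disp_t) (P : qmodType A d1)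
    (Q : qmodType A d2) : Prop :=
  exists (f : P -> Q) (g : Q -> P),
    [/\ module_hom f, module_hom g, cancel f g & cancel g f].

Definition projective (d : Order.disp_t) (P : qmodType A d) : Prop :=
  forall (d1 d2 : Order.disp_t) (R : qmodType A d1) (S : qmodType A d2)
    (g : R -> S) (h : P -> S),
    module_hom g -> (forall y, exists x, g x = y) -> module_hom h ->
    exists h' : P -> R, module_hom h' /\ g \o h' = h.

Record structural_nucleus (d : Order.disp_t) (Q : qmodType A d) := {
  nucleus_fun :> Q -> Q;
  nucleus_homo : {homo nucleus_fun : x y / x <= y};
  nucleus_ge : forall x, x <= nucleus_fun x;
  nucleus_idem : forall x, nucleus_fun (nucleus_fun x) = nucleus_fun x;
  nucleus_add : forall x y,
    qadd (nucleus_fun x) (nucleus_fun y) <= nucleus_fun (qadd x y);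
  nucleus_act : forall (a : A) x,
    qact a (nucleus_fun x) <= nucleus_fun (qact a x);
}.

(* x |-_gamma y *)
Definition entails (d : Order.disp_t) (Q : qmodType A d)
    (gamma : structural_nucleus Q) (x y : Q) : Prop := y <= gamma x.

(* One of the two symmetric conditions on tau and rho; the other one is
   translation_cond delta gamma rho tau. *)
Definition translation_cond (dP dQ : Order.disp_t) (P : qmodType A dP)
    (Q : qmodType A dQ) (gamma : structural_nucleus P)
    (delta : structural_nucleus Q) (tau : P -> Q) (rho : Q -> P) : Prop :=
  (forall G D : P, entails gamma G D <-> entails delta (tau G) (tau D)) /\
  (forall E : Q,
    entails delta E ((tau \o rho) E) /\ entails delta ((tau \o rho) E) E).

Definition nucleus_image (d : Order.disp_t) (Q : qmodType A d)
    (gamma : structural_nucleus Q) : Type := set_type (range gamma).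

Section NucleusImage.
Context {d : Order.disp_t} {Q : qmodType A d} (gamma : structural_nucleus Q).
Local Notation Qg := (nucleus_image gamma).

HB.instance Definition _ := SubChoice.on Qg.
HB.instance Definition _ := [SubChoice_isSubPOrder of Qg by <: with d].

Definition to_image (x : Q) : Qg :=
  exist _ (gamma x) (mem_set (imageT gamma x)).

Definition nuc_join (X : set Qg) : Qg := to_image (qjoin (val @` X)).
Definition nuc_add (x y : Qg) : Qg := to_image (qadd (val x) (val y)).
Definition nuc_zero : Qg := to_image qzero.
Definition nuc_act (a : A) (x : Qg) : Qg := to_image (qact a (val x)).


Let gK (x : Qg) : gamma (val x) = val x.
Proof. by case: x => x /= /set_mem [y _ <-]; exact: nucleus_idem. Qed.

Let le_g x y : (gamma x <= gamma y) = (x <= gamma y).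
Proof.
apply/idP/idP => [|h]; first exact: le_trans (nucleus_ge gamma x).
by rewrite -(nucleus_idem gamma y); exact: nucleus_homo.
Qed.

Let g_eq x y : x <= gamma y -> y <= gamma x -> gamma x = gamma y.
Proof. by move=> xy yx; apply/eqP; rewrite eq_le !le_g xy yx. Qed.

Let g_add x y : gamma (qadd (gamma x) (gamma y)) = gamma (qadd x y).
Proof.
apply: g_eq; first exact: nucleus_add.
apply: le_trans (nucleus_ge gamma _).
by apply: qadd_le; exact: nucleus_ge.
Qed.

Let g_addl x y : gamma (qadd (gamma x) y) = gamma (qadd x y).
Proof. by rewrite -g_add nucleus_idem g_add. Qed.

Let g_addr x y : gamma (qadd x (gamma y)) = gamma (qadd x y).
Proof. by rewrite -g_add nucleus_idem g_add. Qed.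

Let g_act a x : gamma (qact a (gamma x)) = gamma (qact a x).
Proof.
apply: g_eq; first exact: nucleus_act.
apply: le_trans (nucleus_ge gamma _).
by apply: qact_le => //; exact: nucleus_ge.
Qed.

Let join_ge (X : set Q) x : admissible s X -> X x -> x <= qjoin X.
Proof. by move=> aX Xx; apply: (qjoin_supremum X aX).1. Qed.

Let join_le (X : set Q) y :
  admissible s X -> (forall x, X x -> x <= y) -> qjoin X <= y.
Proof. by move=> aX Xy; apply: (qjoin_supremum X aX).2. Qed.

Let g_join (T : Type) (X : set T) (f : T -> Q) : admissible s X ->
  gamma (qjoin [set gamma (f x) | x in X]) = gamma (qjoin [set f x | x in X]).
Proof.
move=> aX; apply: g_eq; apply: join_le; do ?exact: admissible_image.
- move=> _ [x Xx <-]; apply: nucleus_homo.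
  by apply: join_ge; [exact: admissible_image|exists x].
- move=> _ [x Xx <-]; apply: le_trans (nucleus_ge gamma _).
  apply: le_trans (nucleus_ge gamma _) _.
  by apply: join_ge; [exact: admissible_image|exists x].
Qed.

Let nuc_joinE (T : Type) (X : set T) (f : T -> Q) (h : T -> Qg) :
  admissible s X -> (forall x, val (h x) = gamma (f x)) ->
  to_image (qjoin [set f x | x in X]) = nuc_join [set h x | x in X].
Proof.
move=> aX hf; apply: val_inj; rewrite /= image_comp.
rewrite -g_join //; congr (gamma (qjoin _)).
by apply: eq_imagel => x _ /=; rewrite -hf.
Qed.

Let nuc_join_supremum X : admissible s X -> supremums X (nuc_join X).
Proof.
move=> aX; have aX' := admissible_image val aX; split.
  move=> x Xx; rewrite leEsub /=; apply: le_trans (nucleus_ge gamma _).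
  by apply: join_ge => //; exists x.
move=> y uy; rewrite leEsub /= -(gK y); apply: nucleus_homo.
by apply: join_le => // _ [x Xx <-]; have := uy _ Xx; rewrite leEsub.
Qed.

Let nuc_addA : associative nuc_add.
Proof. by move=> x y z; apply: val_inj; rewrite /= g_addl g_addr qaddA. Qed.

Let nuc_add0q : left_id nuc_zero nuc_add.
Proof. by move=> x; apply: val_inj; rewrite /= g_addl qadd0q gK. Qed.

Let nuc_addq0 : right_id nuc_zero nuc_add.
Proof. by move=> x; apply: val_inj; rewrite /= g_addr qaddq0 gK. Qed.

Let nuc_add_le x x' y y' : x <= x' -> y <= y' -> nuc_add x y <= nuc_add x' y'.
Proof. by rewrite !leEsub => xx' yy'; apply: nucleus_homo; apply: qadd_le. Qed.

Let nuc_add_joinl X y : admissible s X ->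
  nuc_add (nuc_join X) y = nuc_join [set nuc_add x y | x in X].
Proof.
move=> aX; rewrite -(nuc_joinE (f := fun x => qadd (val x) (val y)))//.
apply: val_inj; rewrite /= g_addl qadd_joinl; last exact: admissible_image.
by rewrite image_comp.
Qed.

Let nuc_add_joinr X y : admissible s X ->
  nuc_add y (nuc_join X) = nuc_join [set nuc_add y x | x in X].
Proof.
move=> aX; rewrite -(nuc_joinE (f := fun x => qadd (val y) (val x)))//.
apply: val_inj; rewrite /= g_addr qadd_joinr; last exact: admissible_image.
by rewrite image_comp.
Qed.

HB.instance Definition _ := POrder_isQuantale.Build s _ Qg nuc_join_supremum
  nuc_addA nuc_add0q nuc_addq0 nuc_add_le nuc_add_joinl nuc_add_joinr.

Let nuc_act_le a a' x x' : a <= a' -> x <= x' -> nuc_act a x <= nuc_act a' x'.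
Proof. by rewrite !leEsub => aa' xx'; apply: nucleus_homo; apply: qact_le. Qed.

Let nuc_actM a b x : nuc_act (a * b) x = nuc_act a (nuc_act b x).
Proof. by apply: val_inj; rewrite /= g_act qactM. Qed.

Let nuc_act1 x : nuc_act 1 x = x.
Proof. by apply: val_inj; rewrite /= qact1 gK. Qed.

Let nuc_actDl a b x : nuc_act (qadd a b) x = qadd (nuc_act a x) (nuc_act b x).
Proof. by apply: val_inj; rewrite /= g_add qactDl. Qed.

Let nuc_act0 x : nuc_act qzero x = qzero.
Proof. by apply: val_inj; rewrite /= qact0. Qed.

Let nuc_act_joinl (X : set A) x : admissible s X ->
  nuc_act (qjoin X) x = qjoin [set nuc_act a x | a in X].
Proof.
move=> aX; rewrite -[RHS](nuc_joinE (f := fun a => qact a (val x)))//.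
by rewrite /nuc_act qact_joinl.
Qed.

Let nuc_act_qiota_hom (c : Ad) : quantale_hom (nuc_act (qiota c)).
Proof.
have [hj hD h0] := @qact_iota_hom _ _ _ _ _ Q c; split.
- move=> X aX; rewrite -[RHS](nuc_joinE (f := fun x => qact (qiota c) (val x)))//.
  apply: val_inj; rewrite /= g_act hj; last exact: admissible_image.
  by rewrite image_comp.
- by move=> x y; apply: val_inj; rewrite /= g_act hD g_add.
- by apply: val_inj; rewrite /= g_act h0.
Qed.

HB.instance Definition _ := Quantale_isQModule.Build s Ad dA A _ Qg
  nuc_act_le nuc_actM nuc_act1 nuc_actDl nuc_act0 nuc_act_joinl
  nuc_act_qiota_hom.

End NucleusImage.
End ModuleTheory.

(* Main.v *)
Require Import Defs.
From mathcomp Require Import all_boot all_order.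
From mathcomp Require Import boolp classical_sets.

(** The projection [to_image gamma : P -> P_gamma] is a surjective module
    homomorphism, and [x |-_gamma y] means that the class of [y] lies below
    that of [x].  Projectivity lifts an isomorphism [P_gamma -> Q_delta] and its
    inverse along the projections to [tau] and [rho]; conversely, a translation
    [tau] induces a map on the images, which is a homomorphism because its
    composite with the projection is one.  Conditions (1) and (2) are exchanged
    by applying one of them to [rho E] and [tau G]. *)

Set Implicit Arguments.
Unset Strict Implicit.
Unset Printing Implicit Defensive.

Import Order.TTheory.

Local Open Scope classical_set_scope.
Local Open Scope order_scope.

Lemma admissible_nonempty (s : setting) (T : Type) (X : set T) :
  X !=set0 -> admissible s X.
Proof. by case: s. Qed.

(** For [x <= y] the join of the pair [[set x; y]] is [y]. A pair is non-empty, hence admissible in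
    both settings, so monotonicity follows from preservation of joins. *)
Lemma quantale_hom_le (s : setting) (d1 d2 : Order.disp_t)
    (Q : quantaleType s d1) (R : quantaleType s d2) (f : Q -> R) :
  quantale_hom f -> {homo f : x y / x <= y}.
Proof.
move=> hf x y xy; pose X := [set x; y].
have aX : admissible s X by apply: admissible_nonempty; exists x; left.
have [ubX lubX] := qjoin_supremum X aX.
have jX : qjoin X = y.
  apply/eqP; rewrite eq_le; apply/andP; split; last by apply: ubX; right.
  by apply: lubX => _ [->|->].
rewrite -[in leRHS]jX (qhom_join hf) //.
have [+ _] := qjoin_supremum (f @` X) (admissible_image f aX).
by apply; exists x => //; left.
Qed.

Section ModuleTheory.
Context {s : setting} {Ad : monoidType} {dA : Order.disp_t}.
Context {A : addQuantaleMulType s Ad dA}.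

Lemma module_hom_comp (d1 d2 d3 : Order.disp_t) (P : qmodType A d1)
    (Q : qmodType A d2) (R : qmodType A d3) (f : P -> Q) (g : Q -> R) :
  module_hom f -> module_hom g -> module_hom (g \o f).
Proof.
move=> [[fj fD f0] fa] [[gj gD g0] ga]; split; last by move=> a x /=; rewrite fa ga.
split=> [X aX|x y|] /=; last by rewrite f0 g0.
- by rewrite fj // gj ?image_comp //; exact: admissible_image.
- by rewrite fD gD.
Qed.

(** Arguments in [Q] are replaced by the representatives that the section [r] chooses. Since [p]
    preserves the operations, they can be carried out in [P], where [f \o p] is known to respect
    them; [r] is merely a map of sets. *)
Lemma module_hom_descent (d1 d2 d3 : Order.disp_t) (P : qmodType A d1)
    (Q : qmodType A d2) (R : qmodType A d3) (p : P -> Q) (r : Q -> P)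
    (f : Q -> R) :
  module_hom p -> cancel r p -> module_hom (f \o p) -> module_hom f.
Proof.
move=> [[pj pD p0] pa] rK [[fj fD f0] fa]; split; last first.
  by move=> a x; rewrite -(rK x) -pa; apply: fa.
split=> [X aX|x y|]; last by rewrite -p0; apply: f0.
- have aX' := admissible_image r aX.
  have XE : X = p @` (r @` X).
    by rewrite image_comp (eq_imagel (f' := id)) ?image_id// => x _; apply: rK.
  by rewrite [in LHS]XE -pj // [LHS]fj // -image_comp -XE.
- by rewrite -(rK x) -(rK y) -pD; apply: fD.
Qed.

Section Nucleus.
Context {d : Order.disp_t} {Q : qmodType A d} (gamma : structural_nucleus Q).

Lemma le_nucleus x y : (gamma x <= gamma y) = (x <= gamma y).
Proof.
apply/idP/idP => [|xy]; first exact: le_trans (nucleus_ge gamma x).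
by rewrite -(nucleus_idem gamma y); apply: nucleus_homo.
Qed.

Lemma entailsE x y : entails gamma x y <-> to_image gamma y <= to_image gamma x.
Proof. by rewrite -Order.le_val /= le_nucleus. Qed.

Lemma to_image_eqP x y :
  to_image gamma x = to_image gamma y <-> entails gamma x y /\ entails gamma y x.
Proof.
rewrite !entailsE; split=> [->//|[yx xy]].
by apply/eqP; rewrite eq_le xy yx.
Qed.

Lemma valK_to_image : cancel val (to_image gamma).
Proof.
move=> x; apply: val_inj => /=.
by case: x => x /= /set_mem [y _ <-]; apply: nucleus_idem.
Qed.

Lemma to_image_nucleus x : to_image gamma (gamma x) = to_image gamma x.
Proof. by apply: val_inj; apply: nucleus_idem. Qed.

(** Operations on the image apply [gamma] to the operation on representatives, so the point is that
    replacing arguments by their closures does not change the closure of the result. One inequality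
    is a nucleus law, the other is expansiveness with monotonicity. *)
Lemma to_image_hom : module_hom (to_image gamma).
Proof.
split; last first.
  move=> a x; apply/val_inj/le_anti; rewrite /= !le_nucleus nucleus_act andbT.
  apply: le_trans (nucleus_ge gamma _).
  by apply: qact_le => //; apply: nucleus_ge.
split=> // [X aX|x y].
- have aX' := admissible_image (to_image gamma) aX.
  (* Both joins are suprema, so two universal properties are compared; [le_nucleus] reduces a bound
     on the class of [qjoin X] to a bound on [qjoin X] itself. *)
  have [ub lub] := qjoin_supremum _ aX'; have [ubX lubX] := qjoin_supremum _ aX.
  apply: le_anti; apply/andP; split.
    rewrite -Order.le_val /= le_nucleus; apply: lubX => x Xx.
    rewrite -le_nucleus; have := ub (to_image gamma x).
    by rewrite -Order.le_val; apply; exists x.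
  apply: lub => _ [x Xx <-]; rewrite -Order.le_val /=; apply: nucleus_homo.
  exact: ubX.
- apply/val_inj/le_anti; rewrite /= !le_nucleus nucleus_add andbT.
  apply: le_trans (nucleus_ge gamma _).
  by apply: qadd_le; apply: nucleus_ge.
Qed.

Lemma to_image_surj y : exists x, to_image gamma x = y.
Proof. by exists (val y); apply: valK_to_image. Qed.

End Nucleus.

(** Passing to classes makes the conditions rewrite rules: [tau] induces an order embedding of
    classes, and [rho] is a right inverse of it up to [delta]. *)
Lemma translation_condE (dP dQ : Order.disp_t) (P : qmodType A dP)
    (Q : qmodType A dQ) (gamma : structural_nucleus P)
    (delta : structural_nucleus Q) (tau : P -> Q) (rho : Q -> P) :
  translation_cond gamma delta tau rho <->
  (forall G D, (to_image gamma D <= to_image gamma G) =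
               (to_image delta (tau D) <= to_image delta (tau G))) /\
  (forall E, to_image delta (tau (rho E)) = to_image delta E).
Proof.
split=> -[h1 h2]; split=> [G D|E].
- by have := h1 G D; rewrite !entailsE => h; apply/idP/idP => /h.
- by apply/to_image_eqP; have [? ?] := h2 E.
- by rewrite !entailsE h1.
- by have /to_image_eqP[? ?] := h2 E.
Qed.

Lemma translation_cond_sym (dP dQ : Order.disp_t) (P : qmodType A dP)
    (Q : qmodType A dQ) (gamma : structural_nucleus P)
    (delta : structural_nucleus Q) (tau : P -> Q) (rho : Q -> P) :
  translation_cond gamma delta tau rho -> translation_cond delta gamma rho tau.
Proof.
move=> /translation_condE[h1 h2]; apply/translation_condE; split=> [E F|G].
  by rewrite h1 !h2.
(* The classes of [rho (tau G)] and [G] are compared after applying [tau], where the second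
   condition at [E := tau G] identifies them. *)
by apply: le_anti; rewrite !h1 h2 lexx.
Qed.

(** This is independence of the representative: [gamma x] and [x] have the same class, and [tau]
    preserves the order of classes in both directions. *)
Lemma translation_image_to_image (dP dQ : Order.disp_t) (P : qmodType A dP)
    (Q : qmodType A dQ) (gamma : structural_nucleus P)
    (delta : structural_nucleus Q) (tau : P -> Q) (rho : Q -> P) :
  translation_cond gamma delta tau rho ->
  forall x, to_image delta (tau (val (to_image gamma x))) = to_image delta (tau x).
Proof.
move=> /translation_condE[h1 _] x.
by apply: le_anti; rewrite -!h1 to_image_nucleus lexx.
Qed.

Lemma translation_image_hom (dP dQ : Order.disp_t) (P : qmodType A dP)
    (Q : qmodType A dQ) (gamma : structural_nucleus P)
    (delta : structural_nucleus Q) (tau : P -> Q) (rho : Q -> P) :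
  module_hom tau -> translation_cond gamma delta tau rho ->
  module_hom (fun x : nucleus_image gamma => to_image delta (tau (val x))).
Proof.
move=> htau tr; apply: (module_hom_descent (to_image_hom gamma)).
  exact: valK_to_image.
rewrite (_ : _ \o _ = to_image delta \o tau).
  exact: module_hom_comp htau (to_image_hom delta).
by apply/funext => x; apply: translation_image_to_image tr x.
Qed.

Lemma translation_image_cancel (dP dQ : Order.disp_t) (P : qmodType A dP)
    (Q : qmodType A dQ) (gamma : structural_nucleus P)
    (delta : structural_nucleus Q) (tau : P -> Q) (rho : Q -> P) :
  translation_cond gamma delta tau rho ->
  cancel (fun x : nucleus_image gamma => to_image delta (tau (val x)))
         (fun y : nucleus_image delta => to_image gamma (rho (val y))).
Proof.
move=> tr x; have tr' := translation_cond_sym tr.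
(* The canonical representative of the class of [tau (val x)] may be traded for [tau (val x)] itself
   before [rho] is applied. *)
rewrite (translation_image_to_image tr').
by move/translation_condE: tr' => [_ ->]; apply: valK_to_image.
Qed.

Lemma projective_lift_image (dP dQ : Order.disp_t) (P : qmodType A dP)
    (Q : qmodType A dQ) (gamma : structural_nucleus P)
    (delta : structural_nucleus Q)
    (f : nucleus_image gamma -> nucleus_image delta) :
  projective P -> module_hom f ->
  exists2 tau : P -> Q, module_hom tau &
    forall x, to_image delta (tau x) = f (to_image gamma x).
Proof.
move=> projP hf.
have [tau [htau e]] := projP _ _ _ _ _ _ (to_image_hom delta)
  (@to_image_surj _ _ delta) (module_hom_comp (to_image_hom gamma) hf).
by exists tau => // x; apply: (congr1 (@^~ x) e).
Qed.

(** A bijection that is monotone together with its inverse is an order embedding, and this transfers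
    from [f] to [tau] on classes. *)
Lemma translation_cond_lift (dP dQ : Order.disp_t) (P : qmodType A dP)
    (Q : qmodType A dQ) (gamma : structural_nucleus P)
    (delta : structural_nucleus Q)
    (f : nucleus_image gamma -> nucleus_image delta)
    (g : nucleus_image delta -> nucleus_image gamma)
    (tau : P -> Q) (rho : Q -> P) :
  module_hom f -> module_hom g -> cancel f g -> cancel g f ->
  (forall x, to_image delta (tau x) = f (to_image gamma x)) ->
  (forall y, to_image gamma (rho y) = g (to_image delta y)) ->
  translation_cond gamma delta tau rho.
Proof.
move=> hf hg fK gK tauE rhoE; apply/translation_condE; split=> [G D|E].
  rewrite !tauE; apply/idP/idP => [|/(quantale_hom_le hg)]; last by rewrite !fK.
  exact: quantale_hom_le hf _ _.
by rewrite tauE rhoE gK.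
Qed.

End ModuleTheory.

Theorem theorem7p3 (s : setting) (Ad : monoidType) (dA dP dQ : Order.disp_t)
    (A : addQuantaleMulType s Ad dA) (P : qmodType A dP) (Q : qmodType A dQ)
    (projP : projective P) (projQ : projective Q)
    (gamma : structural_nucleus P) (delta : structural_nucleus Q) :
  (module_isomorphic (nucleus_image gamma) (nucleus_image delta) <->
   exists (tau : P -> Q) (rho : Q -> P),
     [/\ module_hom tau, module_hom rho,
         translation_cond gamma delta tau rho &
         translation_cond delta gamma rho tau]) /\
  (forall (tau : P -> Q) (rho : Q -> P), module_hom tau -> module_hom rho ->
     translation_cond gamma delta tau rho <->
     translation_cond delta gamma rho tau).
Proof.
split; last by move=> tau rho _ _; split; apply: translation_cond_sym.
split=> [[f [g [hf hg fK gK]]]|[tau [rho [htau hrho tr tr']]]].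
  have [tau htau tauE] := projective_lift_image projP hf.
  have [rho hrho rhoE] := projective_lift_image projQ hg.
  have tr := translation_cond_lift hf hg fK gK tauE rhoE.
  by exists tau, rho; split=> //; apply: translation_cond_sym.
exists (fun x => to_image delta (tau (val x))),
  (fun y => to_image gamma (rho (val y))).
split; [exact: translation_image_hom tr|exact: translation_image_hom tr'| |];
  exact: translation_image_cancel.
Qed.
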